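(* Let $\mathcal{A}\in\mathcal{H}(s_{i,j})$ be a complete hypertetrahedral arrangement in $\mathbb{P}^n$, and let $0\le i_0\le n$ be an integer such that $$\sum_{\substack{j=0\\ j\ne i_0}}^n s_{i_0,j}=\min\Big\{\sum_{\substack{j=0\\ j\ne i}}^n s_{i,j}\;:\;0\le i\le n\Big\}.$$ Then the Jacobian ideal $J_{\mathcal{A}}$ has a (nonzero) syzygy of degree $\sum_{j\ne i_0}s_{i_0,j}+1$. In particular, $$\mathrm{indeg}(\mathrm{syz}(J_{\mathcal{A}}))\le \sum_{\substack{j=0\\ j\neq i_0}}^{n}s_{i_0,j}+1.$$
   Context: $\Bbbk$ is an algebraically closed field of characteristic $0$, $R=\Bbbk[x_0,\dots,x_n]$, $\mathbb{P}^n=\mathrm{Proj}(R)$. For a hyperplane arrangement $\mathcal{A}$ (finite set of distinct hyperplanes in $\mathbb{P}^n$), $f_{\mathcal{A}}$ is the product of linear forms defining its hyperplanes, $J_{\mathcal{A}}=(\partial_{x_0}f_{\mathcal{A}},\dots,\partial_{x_n}f_{\mathcal{A}})$ is its Jacobian ideal, and $\mathrm{syz}(J_{\mathcal{A}})=\{(g_0,\dots,g_n)\in R^{n+1}:\sum_i g_i\,\partial_{x_i}f_{\mathcal{A}}=0\}$, graded so that a syzygy has degree $d$ when all $g_i\in R_d$. For a graded module $M$, $\mathrm{indeg}(M)$ is the minimum degree of a nonzero homogeneous element. For $0\le i<j\le n$ let $\mathcal{L}_{i,j}=\{x_i=x_j=0\}$. A hypertetrahedral arrangement in $\mathbb{P}^n$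 is one in which every hyperplane contains some $\mathcal{L}_{i,j}$; it is complete if it contains all coordinate hyperplanes $\{x_i=0\}$, $0\le i\le n$. For integers $s_{i,j}\ge 1$ ($0\le i<j\le n$), $\mathcal{H}(s_{i,j})$ is the set of complete hypertetrahedral arrangements with exactly $s_{i,j}+2$ hyperplanes through $\mathcal{L}_{i,j}$ for all $i<j$. The convention $s_{j,i}=s_{i,j}$ is used. *)

(* Defs.v *)
From HB Require Import structures.
From mathcomp Require Import all_boot all_order all_algebra finmap mpoly.

Set Implicit Arguments.
Unset Strict Implicit.
Unset Printing Implicit Defensive.

Import GRing.Theory.
Local Open Scope ring_scope.
Local Open Scope fset_scope.

(* A linear subspace of P^n is represented by its affine cone, a subspace of  *)
(* k^(n+1); a hyperplane of P^n is then a subspace of dimension n.            *)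

Definition is_arrangement (k : fieldType) (n : nat)
    (A : {fset {vspace 'rV[k]_n.+1}}) : Prop :=
  forall H, H \in A -> \dim H = n.

Definition defines (k : fieldType) (n : nat)
    (l : {mpoly k[n.+1]}) (H : {vspace 'rV[k]_n.+1}) : Prop :=
  l \is 1.-homog /\ forall v : 'rV[k]_n.+1, v \in H <-> l.@[v 0] = 0.

(* f_A is only determined up to a nonzero scalar, by the choice of a linear   *)
(* form l H for each hyperplane H; hence a predicate and not a function.      *)
Definition is_defining_poly (k : fieldType) (n : nat)
    (A : {fset {vspace 'rV[k]_n.+1}}) (f : {mpoly k[n.+1]}) : Prop :=
  exists l : {vspace 'rV[k]_n.+1} -> {mpoly k[n.+1]},
    (forall H, H \in A -> defines (l H) H) /\ f = \prod_(H <- A) l H.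

(* {x_i = 0}: [col i v] is the 1 x 1 matrix with entry the coordinate v_i. *)
Definition coord_hyperplane (k : fieldType) (n : nat) (i : 'I_n.+1) :
    {vspace 'rV[k]_n.+1} :=
  lker (linfun (@col k 1 n.+1 i)).

Definition coord_codim2 (k : fieldType) (n : nat) (i j : 'I_n.+1) :
    {vspace 'rV[k]_n.+1} :=
  (coord_hyperplane k i :&: coord_hyperplane k j)%VS.

Definition hypertetrahedral (k : fieldType) (n : nat)
    (A : {fset {vspace 'rV[k]_n.+1}}) : Prop :=
  is_arrangement A /\
  forall H, H \in A ->
    exists i j : 'I_n.+1, (i < j)%N /\ (coord_codim2 k i j <= H)%VS.

Definition complete (k : fieldType) (n : nat)
    (A : {fset {vspace 'rV[k]_n.+1}}) : Prop :=
  forall i : 'I_n.+1, coord_hyperplane k i \in A.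

(* The class H(s_{i,j}); only the values s i j with i < j matter. *)
Definition in_calH (k : fieldType) (n : nat) (s : 'I_n.+1 -> 'I_n.+1 -> nat)
    (A : {fset {vspace 'rV[k]_n.+1}}) : Prop :=
  [/\ hypertetrahedral A, complete A &
      forall i j : 'I_n.+1, (i < j)%N ->
        #|` [fset H in A | (coord_codim2 k i j <= H)%VS]| = (s i j + 2)%N].

(* Syzygies of the Jacobian ideal of f, with respect to its generators        *)
(* the partial derivatives.                                                   *)
Definition syz_jacobian (k : fieldType) (n : nat) (f : {mpoly k[n.+1]})
    (g : 'rV[{mpoly k[n.+1]}]_n.+1) : Prop :=
  \sum_(i < n.+1) g 0 i * f^`M(i) = 0.

Definition homog_of_degree (k : fieldType) (n m : nat) (d : nat)
    (g : 'rV[{mpoly k[n]}]_m) : Prop :=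
  forall i, g 0 i \is d.-homog.

(* [is_indeg M d]: indeg M = d, for a graded submodule M of R^m.              *)
Definition is_indeg (k : fieldType) (n m : nat)
    (M : 'rV[{mpoly k[n]}]_m -> Prop) (d : nat) : Prop :=
  (exists g, [/\ M g, g != 0 & homog_of_degree d g]) /\
  (forall e g, M g -> g != 0 -> homog_of_degree e g -> (d <= e)%N).

(* Main.v *)
(* Write f = F G, where F collects the linear forms in which x_{i0} occurs,   *)
(* so that dG/dx_{i0} = 0. The derivation F d/dx_{i0} multiplies f by         *)
(* dF/dx_{i0}, and so does (dF/dx_{i0}) E / N, where E is the Euler           *)
(* derivation and N = deg f; their difference kills f and has degree deg F.   *)
(* As N is invertible, it vanishes only if F = 0. A hyperplane whose form     *)
(* involves x_{i0} is {x_{i0} = 0} or one of the s_{i0,j} non-coordinate      *)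
(* hyperplanes through some L_{i0,j}, so deg F is at most the required        *)
(* degree; a power of x_{i0} makes up any difference.                         *)

Require Import Defs.
From HB Require Import structures.
From mathcomp Require Import all_boot all_order all_algebra finmap mpoly.
From Stdlib Require Import Classical_Prop.

Set Implicit Arguments.
Unset Strict Implicit.
Unset Printing Implicit Defensive.

Import GRing.Theory.
Local Open Scope ring_scope.
Local Open Scope fset_scope.

(** The forms involving x_{i0} belong to the hyperplanes that miss the coordinate point e_{i0} =
    [delta_mx 0 i0]; this criterion defines the split f = F G. [mderiv_dhomog1] turns it into
    dG/dx_{i0} = 0, [syz_euler_corrected] and [euler_corrected_neq0] then give a nonzero syzygy of
    degree deg F, and [card_delta_notin] bounds deg F by counting hyperplanes. *)

Lemma mpolyX_neq0 (n : nat) (R : nzRingType) (m : 'X_{1..n}) :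
  'X_[m] != 0 :> {mpoly R[n]}.
Proof. by rewrite -msupp_eq0 msuppX. Qed.

Lemma dhomog_mderiv (n : nat) (R : nzRingType) (d : nat) (p : {mpoly R[n]})
    (i : 'I_n) : p \is d.+1.-homog -> p^`M(i) \is d.-homog.
Proof.
move=> hp; apply/dhomogP => m; rewrite mcoeff_msupp mcoeff_mderiv => nz.
have : (m + U_(i))%MM \in msupp p.
  by rewrite mcoeff_msupp; apply: contraNneq nz => ->; rewrite mul0rn.
move/(dhomog_mf hp) => /=; rewrite mdegD mdeg1 addn1.
by case.
Qed.

Lemma euler_mpoly (n : nat) (R : comNzRingType) (d : nat) (p : {mpoly R[n]}) :
  p \is d.-homog -> \sum_(i < n) 'X_i * p^`M(i) = p *+ d.
Proof.
move=> hp.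
have euler_mon (m : 'X_{1..n}) :
    \sum_(i < n) 'X_i * ('X_[m])^`M(i) = 'X_[m] *+ mdeg m :> {mpoly R[n]}.
  rewrite mdegE -sumrMnr; apply: eq_bigr => i _.
  rewrite mderivX scaler_nat mulrnAr -mpolyXD.
  (* If x_i does not occur, the truncated exponent [m - U_(i)] is harmless: its coefficient is 0. *)
  have [->|mi_gt0] := posnP (m i); first by rewrite !mulr0n.
  by rewrite addmC submK // lep1mP -lt0n.
rewrite [in RHS](mpolyE p) -sumrMnl.
under eq_bigr => i _.
  rewrite {1}[p]mpolyE raddf_sum mulr_sumr.
  over.
rewrite exchange_big /=; apply: eq_big_seq => m /(dhomog_mf hp) /= <-.
rewrite scalerMnr -euler_mon scaler_sumr; apply: eq_bigr => i _.
by rewrite mderivZ scalerAr.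
Qed.

(** The derivative is constant, and Euler's formula evaluated at e_i isolates it. Hence a hyperplane
    contains e_i exactly when its form does not involve x_i. *)
Lemma mderiv_dhomog1 (n : nat) (R : comNzRingType) (l : {mpoly R[n]})
    (i : 'I_n) :
  l \is 1.-homog -> l^`M(i) = (l.@[(delta_mx 0 i : 'rV[R]_n) 0])%:MP.
Proof.
move=> hl.
have const_deriv j : l^`M(j) = ((l^`M(j))@_0%MM)%:MP.
  have /dhomogP h0 := dhomog_mderiv j hl.
  apply/mpolyP => m; rewrite mcoeffC; have [->|nz] := eqVneq 0%MM m.
    by rewrite mulr1.
  rewrite mulr0; apply/memN_msupp_eq0/negP => /h0 /= /eqP.
  by rewrite mdeg_eq0 eq_sym (negPf nz).
rewrite -[l in RHS]mulr1n -(euler_mpoly hl).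
rewrite (big_morph _ (mevalD _) (meval0 _)) (bigD1 i) //=.
rewrite big1 ?addr0 => [|j ji]; rewrite mevalM mevalXU mxE ?eqxx.
  by rewrite {1 2}const_deriv mevalC mul1r.
by rewrite (negPf ji) mul0r.
Qed.

Lemma dhomog_prod1 (n : nat) (R : comNzRingType) (I : eqType) (r : seq I)
    (l : I -> {mpoly R[n]}) :
  (forall i, i \in r -> l i \is 1.-homog) ->
  \prod_(i <- r) l i \is (size r).-homog.
Proof.
elim: r => [|i r IHr] hl; first by rewrite big_nil dhomog1.
rewrite big_cons /= -add1n dhomogM ?hl ?mem_head // IHr // => j jr.
by rewrite hl // in_cons jr orbT.
Qed.

Lemma mderiv_prod0 (n : nat) (R : comNzRingType) (I : eqType) (r : seq I)
    (l : I -> {mpoly R[n]}) (i : 'I_n) :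
  (forall j, j \in r -> (l j)^`M(i) = 0) ->
  (\prod_(j <- r) l j)^`M(i) = 0.
Proof.
move=> dl; rewrite big_seq; elim/big_ind: _ => [|p q dp dq|j /dl //].
  by rewrite -mpolyC1 mderivC.
by rewrite mderivM dp dq mul0r mulr0 addr0.
Qed.

(* The coefficients of N F d/dx_{i0} - (dF/dx_{i0}) E, denominators cleared.  *)
Definition euler_corrected (k : fieldType) (n : nat) (N : nat)
    (F : {mpoly k[n.+1]}) (i0 : 'I_n.+1) : 'rV[{mpoly k[n.+1]}]_n.+1 :=
  \row_i (F *+ N *+ (i == i0) - 'X_i * F^`M(i0)).

Lemma syz_euler_corrected (k : fieldType) (n N : nat) (F G : {mpoly k[n.+1]})
    (i0 : 'I_n.+1) :
  F * G \is N.-homog -> G^`M(i0) = 0 ->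
  syz_jacobian (F * G) (euler_corrected N F i0).
Proof.
move=> hFG dG; rewrite /syz_jacobian.
under eq_bigr => i _ do rewrite mxE mulrBl -mulrA mulrCA.
rewrite sumrB -mulr_sumr (euler_mpoly hFG) (bigD1 i0) //= eqxx.
rewrite big1 => [|i /negPf->]; last by rewrite mulr0n mul0r.
rewrite mulr1n addr0 mderivM dG mulr0 addr0 mulrnAl mulrnAr.
by rewrite mulrCA subrr.
Qed.

Lemma homog_euler_corrected (k : fieldType) (n N d : nat)
    (F : {mpoly k[n.+1]}) (i0 : 'I_n.+1) :
  F \is d.-homog -> homog_of_degree d (euler_corrected N F i0).
Proof.
move=> hF i; rewrite mxE rpredB ?rpredMn //.
case: d hF => [|d] hF; last first.
  by rewrite -[d.+1]add1n dhomogM ?dhomogX /= ?mdeg1 // dhomog_mderiv.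
(* In degree 0 the count 1 + (d - 1) fails, but F is constant. *)
suff -> : F^`M(i0) = 0 by rewrite mulr0 rpred0.
apply/mpolyP => m; rewrite mcoeff_mderiv mcoeff0 (dhomog_nemf_coeff hF) ?mul0rn //=.
by rewrite mdegD mdeg1 addn1.
Qed.

(** Vanishing of an entry i != i0 forces dF/dx_{i0} = 0, which leaves N F as the entry at i0. *)
Lemma euler_corrected_neq0 (k : fieldType) (n N : nat) (F : {mpoly k[n.+1]})
    (i0 i : 'I_n.+1) :
  i != i0 -> N%:R != 0 :> k -> F != 0 -> euler_corrected N F i0 != 0.
Proof.
move=> ii0 N0 F0; apply/eqP => /rowP g0.
have dF : F^`M(i0) = 0.
  move: (g0 i); rewrite !mxE (negPf ii0) mulr0n sub0r => /eqP.
  by rewrite oppr_eq0 mulf_eq0 (negPf (mpolyX_neq0 _ _)) => /eqP.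
move: (g0 i0); rewrite !mxE eqxx dF mulr0 subr0 mulr1n => /eqP.
by rewrite -scaler_nat scaler_eq0 (negPf N0) (negPf F0).
Qed.

(** Descent on the degree; excluded middle decides whether a smaller one occurs. *)
Lemma indeg_le (k : fieldType) (n m : nat)
    (M : 'rV[{mpoly k[n]}]_m -> Prop) (d : nat) :
  (exists g, [/\ M g, g != 0 & homog_of_degree d g]) ->
  exists e, is_indeg M e /\ (e <= d)%N.
Proof.
have [D] := ubnP d; elim: D d => // D IHD d; rewrite ltnS => leD hd.
have [[e [lt_ed he]]|no] := classic (exists e, (e < d)%N /\
    exists g, [/\ M g, g != 0 & homog_of_degree e g]).
  have [e' [ind le_e']] := IHD e (leq_trans lt_ed leD) he.
  by exists e'; rewrite (leq_trans le_e' (ltnW lt_ed)).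
exists d; split=> //; split=> // e g Mg g0 hg; rewrite leqNgt.
by apply/negP => lt_ed; apply: no; exists e; split=> //; exists g.
Qed.

Lemma memv_coord_hyperplane (k : fieldType) (n : nat) (i : 'I_n.+1)
    (v : 'rV[k]_n.+1) : (v \in coord_hyperplane k i) = (v 0 i == 0).
Proof.
rewrite memv_ker lfunE /=; apply/eqP/eqP => [/matrixP/(_ 0 0)|vi].
  by rewrite !mxE.
by apply/matrixP => a b; rewrite !mxE ord1.
Qed.

Lemma cardfs_bigcup_le (I K : choiceType) (r : seq I) (P : pred I)
    (X : I -> {fset K}) :
  (#|` \bigcup_(i <- r | P i) X i| <= \sum_(i <- r | P i) #|` X i|)%N.
Proof.
elim/big_ind2: _ => [|S a T b hS hT|//]; first by rewrite cardfs0.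
by rewrite cardfsU (leq_trans (leq_subr _ _)) ?leq_add.
Qed.

(** A hyperplane missing e_{i0} contains some L_{i0,j}. Of the s_{i0,j} + 2 hyperplanes through it,
    {x_j = 0} contains e_{i0}, and {x_{i0} = 0} is common to all j, so it is counted once: this is
    the final + 1. *)
Lemma card_delta_notin (k : fieldType) (n : nat)
    (s : 'I_n.+1 -> 'I_n.+1 -> nat) (A : {fset {vspace 'rV[k]_n.+1}})
    (i0 : 'I_n.+1) :
  (forall i j, s j i = s i j) -> in_calH s A ->
  (#|` [fset H in A | delta_mx 0%R i0 \notin H]| <=
     \sum_(j < n.+1 | j != i0) s i0 j + 1)%N.
Proof.
move=> s_sym [[_ hypA] complA cardA].
pose C := @coord_hyperplane k n; pose e0 : 'rV[k]_n.+1 := delta_mx 0 i0.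
have e0C j : (e0 \in C j) = (j != i0).
  by rewrite memv_coord_hyperplane mxE eqxx /=; case: (j == i0); rewrite ?oner_eq0 ?eqxx.
pose X j := [fset H in A | (coord_codim2 k i0 j <= H)%VS] `\ C i0 `\ C j.
have cardX j : j != i0 -> #|` X j| = s i0 j.
  move=> ji0.
  have CC : C j != C i0.
    by apply/eqP => CC; move: (e0C j); rewrite CC e0C eqxx ji0.
  have cX : #|` [fset H in A | (coord_codim2 k i0 j <= H)%VS]| = (s i0 j + 2)%N.
    have [lt|lt|/val_inj ij] := ltngtP i0 j; first exact: cardA.
      by rewrite s_sym -(cardA j i0 lt) /coord_codim2 capvC.
    by rewrite ij eqxx in ji0.
  move: cX; rewrite (cardfsD1 (C i0)) (cardfsD1 (C j) (_ `\ _)) !inE CC.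
  rewrite !complA capvSl capvSr /= -/(X j) addnA addnC.
  by move/addIn.
apply: (@leq_trans #|` C i0 |` \bigcup_(j <- index_enum 'I_n.+1 | j != i0) X j|).
  apply: fsubset_leq_card; apply/fsubsetP => H; rewrite !inE /=.
  move=> /andP[HA e0H]; have [//|HC0 /=] := eqVneq H (C i0).
  have [i [j [ltij sub]]] := hypA H HA.
  have inX j' : j' != i0 -> (coord_codim2 k i0 j' <= H)%VS ->
      H \in \bigcup_(j <- index_enum 'I_n.+1 | j != i0) X j.
    move=> j'i0 subj'; apply/bigfcupP; exists j'.
      by rewrite mem_index_enum.
    rewrite !inE HA HC0 subj' !andbT; apply: contraNneq e0H => ->.
    by rewrite e0C.
  (* If neither index were i0, then e_{i0} would lie in L_{i,j}, hence in H. *)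
  have : ~~ ((i != i0) && (j != i0)).
    apply: contra e0H => ij; apply: (subvP sub).
    by rewrite memv_cap !e0C.
  rewrite negb_and !negbK => /orP[] /eqP E; subst.
    by apply: (inX j) => //; rewrite neq_ltn ltij orbT.
  by apply: (inX i); rewrite ?neq_ltn ?ltij // /coord_codim2 capvC.
rewrite addnC cardfsU1 leq_add ?leq_b1 //.
apply: leq_trans (cardfs_bigcup_le _ _ _) _.
by rewrite (eq_bigr _ cardX).
Qed.

Theorem proposition4p1 (k : closedFieldType) (n : nat)
    (s : 'I_n.+1 -> 'I_n.+1 -> nat)
    (A : {fset {vspace 'rV[k]_n.+1}}) (f : {mpoly k[n.+1]}) (i0 : 'I_n.+1)
    (k_char0 : [pchar k] =i pred0)
    (s_ge1 : forall i j : 'I_n.+1, (i < j)%N -> (1 <= s i j)%N)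
    (s_sym : forall i j : 'I_n.+1, s j i = s i j)
    (A_calH : in_calH s A)
    (f_A : is_defining_poly A f)
    (i0_min : forall i : 'I_n.+1,
       (\sum_(j < n.+1 | j != i0) s i0 j <= \sum_(j < n.+1 | j != i) s i j)%N) :
  (exists g : 'rV[{mpoly k[n.+1]}]_n.+1,
     [/\ syz_jacobian f g, g != 0 &
         homog_of_degree (\sum_(j < n.+1 | j != i0) s i0 j + 1)%N g]) /\
  (exists d : nat, is_indeg (syz_jacobian f) d /\
     (d <= \sum_(j < n.+1 | j != i0) s i0 j + 1)%N).
Proof.
set D := (_ + 1)%N.
suff ex_g : exists g : 'rV[{mpoly k[n.+1]}]_n.+1,
    [/\ syz_jacobian f g, g != 0 & homog_of_degree D g].
  by split=> //; apply: indeg_le.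
have := card_delta_notin i0 s_sym A_calH; rewrite -/D.
have [[arrA hypA] complA _] := A_calH.
have [l [l_def ->]] := f_A.
set B := [fset H in A | _] => leBD.
pose F := \prod_(H <- B) l H; pose G := \prod_(H <- A `\` B) l H.
have fE : \prod_(H <- A) l H = F * G.
  rewrite (big_fsetID _ (mem B)) /=; congr (_ * _); apply: eq_fbigl => H.
    by rewrite !inE /=; case: (H \in A).
  by rewrite !inE /= andbC.
have l_homog H : H \in A -> l H \is 1.-homog by case/l_def.
have hF : F \is (#|` B|).-homog.
  by apply: dhomog_prod1 => H; rewrite !inE => /andP[/l_homog].
have dG : G^`M(i0) = 0.
  apply: mderiv_prod0 => H; rewrite !inE /= => /andP[+ HA].
  rewrite HA negbK => /(proj2 (l_def H HA)) /= l0.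
  by rewrite mderiv_dhomog1 ?l_homog // l0.
have F0 : F != 0.
  rewrite prodf_seq_neq0; apply/allP => H; rewrite !inE /= => /andP[HA].
  apply: contraNneq => lH0.
  by apply/(proj2 (l_def H HA)); rewrite lH0 meval0.
(* A hyperplane of the arrangement supplies a pair i < j, which excludes n = 0. *)
have [i ii0] : exists i, i != i0.
  have [i [j [ltij _]]] := hypA _ (complA i0).
  have [<-|] := eqVneq i i0; last by exists i.
  by exists j; rewrite neq_ltn ltij orbT.
have N0 : (#|` A|)%:R != 0 :> k.
  rewrite (proj1 (pcharf0P k) k_char0) cardfs_eq0; apply/eqP => A0.
  by have := complA i0; rewrite A0.
have syz_g : syz_jacobian (F * G) (euler_corrected #|` A| F i0).
  by apply: syz_euler_corrected; rewrite // -fE; apply: dhomog_prod1.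
exists ('X_i0 ^+ (D - #|` B|) *: euler_corrected #|` A| F i0).
rewrite fE; split.
- rewrite /syz_jacobian; under eq_bigr => j _ do rewrite mxE -mulrA.
  by rewrite -mulr_sumr syz_g mulr0.
- have : euler_corrected #|` A| F i0 != 0 by exact: euler_corrected_neq0 ii0 N0 F0.
  apply: contraNneq => /rowP Xg0; apply/eqP/rowP => j; move: (Xg0 j).
  rewrite [LHS]mxE !(mxE _ _ 0 j) => /eqP; rewrite mulf_eq0 => /orP[|/eqP //].
  by rewrite expf_eq0 (negPf (mpolyX_neq0 _ _)) andbF.
- move=> j; rewrite mxE -(subnK leBD) dhomogM ?homog_euler_corrected //.
  by rewrite mpolyXn dhomogX /= mdegMn mdeg1 mul1n addnK.
Qed.
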